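(* Let $n\ge 2$, let $W\in\mathbb{R}^{n^2\times n^2}$ be symmetric, $c\in\mathbb{R}^{n^2}$, $d\in\mathbb{R}$, and let $E(X)=x^TWx+c^Tx+d$, where $x\in\mathbb{R}^{n^2}$ is the column stack of $X\in\mathbb{R}^{n\times n}$. Let $v_{\mathrm{S}}$, $v_{\mathrm{DS}}$, $v_{\mathrm{DS}+}$, $v_{\mathrm{DS}++}$ and $v_{\mathrm{SDP}}$ denote the optimal values of the spectral relaxation (S), the doubly stochastic relaxation (DS), the relaxation (DS+), the relaxation (DS++) and the semidefinite relaxation (SDP), respectively, of the problem of minimizing $E$ over the $n\times n$ permutation matrices, as defined in the context. Then: (i) The DS++ relaxation is more accurate than DS+: $v_{\mathrm{DS}++}\ge v_{\mathrm{DS}+}$. (ii) DS+ is more accurate than the spectral and doubly stochastic relaxations, whenever the latter are applicable: if $c=0$ then $v_{\mathrm{DS}+}\ge v_{\mathrm{S}}$, and if $W\succeq 0$ then $v_{\mathrm{DS}+}\ge v_{\mathrm{DS}}$. (iii) The semidefinite relaxation (SDP) is more accurate than each of the relaxations (DS++), (DS+), (S) and (DS), the last two whenever they are applicable: $v_{\mathrm{SDP}}\ge v_{\mathrm{DS}++}$ and $v_{\mathrm{SDP}}\ge v_{\mathrm{DS}+}$; moreover $v_{\mathrm{SDP}}\ge v_{\mathrm{S}}$ if $c=0$, and $v_{\mathrm{SDP}}\ge v_{\mathrm{DS}}$ if $W\succeq 0$.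
   Context: Notation. For $X\in\mathbb{R}^{n\times n}$, $x=[X_{11},X_{21},\ldots,X_{nn}]^T\in\mathbb{R}^{n^2}$ is its column stack, and $\|X\|_F$ is the Frobenius norm. $\mathbf 1\in\mathbb{R}^n$ is the all-ones vector. $\mathrm{DS}$ is the set of doubly stochastic matrices: $X\in\mathbb{R}^{n\times n}$ with $X\mathbf 1=\mathbf 1$, $\mathbf 1^TX=\mathbf 1^T$, $X\ge 0$ entrywise. The linear equations $X\mathbf 1=\mathbf 1$, $\mathbf 1^TX=\mathbf 1^T$ are written as $Ax=b$ with $A\in\mathbb{R}^{2n\times n^2}$, $b\in\mathbb{R}^{2n}$. $F\in\mathbb{R}^{n^2\times (n-1)^2}$ is a matrix with $F^TF=I$ whose columns span the kernel of $A$. For $a\in\mathbb{R}$ let $E(X,a)=E(X)-a\|X\|_F^2+a\,n$. Let $\lambda_{\min}$ be the minimal eigenvalue of $W$ and $\bar\lambda_{\min}$ the minimal eigenvalue of $F^TWF$ (independent of the choice of $F$). The relaxations are all minimization problems. A relaxation is called more accurate than another if its optimal value is greater than or equal to that of the other (i.e. it gives an at least as good lower bound for the minimum of $E$ over permutation matrices). (S) (considered only for $c=0$): minimize $E(X)$ over $X\in\mathbb{R}^{n\times n}$ with $\|X\|_F^2=n$. (DS) (considered only for $W\succeq 0$): minimize $E(X)$ over $X\in\mathrm{DS}$. (DS+): minimize $E(X,\lambda_{\min})$ over $X\in\mathrm{DS}$. (DS++): minimize $E(X,\bar\lambda_{\min})$ over $X\in\mathrm{DS}$. (SDP): minimize $\mathrm{tr}(WY)+c^Tx+d$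 over $X\in\mathbb{R}^{n\times n}$ and symmetric $Y\in\mathbb{R}^{n^2\times n^2}$, where the entry of $Y$ with row index corresponding to the position of $X_{qr}$ in $x$ and column index corresponding to the position of $X_{st}$ in $x$ is denoted $Y_{qrst}$, subject to: $\mathrm{tr}\,Y=n$; $x\ge 0$; $Ax=b$; $Y\succeq xx^T$ (positive semidefinite order); $Y\ge 0$ entrywise; $\sum_{q,r,s,t}Y_{qrst}=n^2$; and for all $q,r,s,t$: $Y_{qrst}\le 0$ if $q=s$ and $r\ne t$; $Y_{qrst}\le 0$ if $r=t$ and $q\neq s$; $Y_{qrst}\le\min\{X_{qr},X_{st}\}$ otherwise. *)

(* Defs.v *)
From HB Require Import structures.
From mathcomp Require Import all_boot all_order all_algebra.
From mathcomp Require Import all_classical all_reals all_analysis.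
Set Implicit Arguments.
Unset Strict Implicit.
Unset Printing Implicit Defensive.
Import Order.TTheory GRing.Theory Num.Theory.
Local Open Scope classical_set_scope.
Local Open Scope ring_scope.

Section Relaxations.
Variables (R : realType) (n : nat).
Implicit Types (X : 'M[R]_n) (W Y : 'M[R]_(n * n)) (c : 'cV[R]_(n * n)) (d : R).

(* [mxvec] stacks the rows of a matrix, hence the transpose. *)
Definition colstack X : 'cV[R]_(n * n) := (mxvec X^T)^T.

Definition pos (q r : 'I_n) : 'I_(n * n) := mxvec_index r q.

Lemma colstackE X q r : colstack X (pos q r) 0 = X q r.
Proof. by rewrite mxE mxvecE mxE. Qed.

(* The position of X_qr is r * n + q (counting from 0): columns are stacked. *)
Lemma pos_val (q r : 'I_n) : pos q r = (r * n + q)%N :> nat.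
Proof.
have card_pos (s : seq 'I_n) : r \in s ->
    index (r, q) [seq (x, y) | x <- s, y <- enum 'I_n] =
    (index r s * n + q)%N.
  elim: s => //= a s IHs; rewrite inE eq_sym => /predU1P[->|rs].
    rewrite eqxx mul0n add0n index_cat map_f ?mem_enum //.
    rewrite index_map; last by move=> ? ? [].
    by rewrite index_enum_ord.
  rewrite index_cat; case: ifPn => [/mapP[y _ [-> _]]|].
    rewrite eqxx mul0n add0n index_map; last by move=> ? ? [].
    by rewrite index_enum_ord.
  case: (eqVneq a r) => [->|_ _].
    by rewrite map_f ?mem_enum.
  by rewrite size_map size_enum_ord IHs // mulSn addnA.
rewrite /pos /mxvec_index /= /enum_rank enum_rank_in.unlock insubdK; last first.
  by rewrite -topredE /= cardE index_mem mem_enum.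
by rewrite enumT unlock /= card_pos ?mem_enum // index_enum_ord.
Qed.

Definition frobenius_norm X : R := Num.sqrt (\sum_i \sum_j X i j ^+ 2).

Definition ds_matrix X : Prop :=
  [/\ X *m const_mx 1 = const_mx 1 :> 'cV[R]_n,
      const_mx 1 *m X = const_mx 1 :> 'rV[R]_n
    & forall i j, 0 <= X i j].

(* The first n rows of A compute the row sums of X, the last n the column
   sums; see [ds_eqsP]. *)
Definition ds_eqs_lhs : 'M[R]_(n + n, n * n) :=
  col_mx (\matrix_(i < n) (colstack (\matrix_(q, r) (q == i)%:R))^T)
         (\matrix_(j < n) (colstack (\matrix_(q, r) (r == j)%:R))^T).

Definition ds_eqs_rhs : 'cV[R]_(n + n) := const_mx 1.

Lemma ds_eqsP X :
  ds_eqs_lhs *m colstack X = ds_eqs_rhs <->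
  X *m const_mx 1 = const_mx 1 :> 'cV[R]_n /\
  const_mx 1 *m X = const_mx 1 :> 'rV[R]_n.
Proof.
have dotE Z : (colstack Z)^T *m colstack X = (\sum_i \sum_j Z i j * X i j)%:M.
  apply/matrixP => a b; rewrite !ord1 [RHS]mxE eqxx mulr1n [LHS]mxE.
  rewrite (reindex _ (curry_mxvec_bij _ _)) /=.
  rewrite (eq_bigr (fun p => (colstack Z)^T 0 (mxvec_index p.1 p.2) *
    colstack X (mxvec_index p.1 p.2) 0)); last by case.
  rewrite -(pair_bigA _ (fun i j => (colstack Z)^T 0 (mxvec_index i j) *
                            colstack X (mxvec_index i j) 0)) /=.
  rewrite exchange_big; apply: eq_bigr => i _; apply: eq_bigr => j _.
  by rewrite mxE !colstackE.
have rowE i : ((\matrix_(i < n) (colstack (\matrix_(q, r) (q == i)%:R))^T)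
    *m colstack X) i 0 = (X *m (const_mx 1 : 'cV_n)) i 0.
  transitivity ((row i ((\matrix_(i < n)
      (colstack (\matrix_(q, r) (q == i)%:R))^T) *m colstack X)) 0 0).
    by rewrite [RHS]mxE.
  rewrite row_mul rowK dotE mxE eqxx mulr1n mxE.
  rewrite (bigD1 i) //= [X in _ + X]big1 ?addr0; last first.
    by move=> k ki; apply: big1 => j _; rewrite mxE (negbTE ki) mul0r.
  by apply: eq_bigr => j _; rewrite !mxE eqxx mul1r mulr1.
have colE j : ((\matrix_(j < n) (colstack (\matrix_(q, r) (r == j)%:R))^T)
    *m colstack X) j 0 = ((const_mx 1 : 'rV_n) *m X) 0 j.
  transitivity ((row j ((\matrix_(j < n)
      (colstack (\matrix_(q, r) (r == j)%:R))^T) *m colstack X)) 0 0).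
    by rewrite [RHS]mxE.
  rewrite row_mul rowK dotE mxE eqxx mulr1n mxE.
  apply: eq_bigr => i _; rewrite (bigD1 j) //= [X in _ + X]big1 ?addr0.
    by rewrite !mxE eqxx.
  by move=> k kj; rewrite mxE (negbTE kj) mul0r.
rewrite /ds_eqs_lhs /ds_eqs_rhs mul_col_mx -col_mx_const; split.
  move=> /eq_col_mx[Er Ec]; split.
    by apply/colP => i; rewrite -rowE Er !mxE.
  by apply/rowP => j; rewrite -colE Ec !mxE.
move=> [Er Ec]; congr col_mx; apply/colP => i.
  by rewrite rowE Er !mxE.
by rewrite colE Ec !mxE.
Qed.

Definition psd m (M : 'M[R]_m) : Prop :=
  M^T = M /\ forall v : 'cV[R]_m, 0 <= (v^T *m M *m v) 0 0.

(* The spectrum is finite, and nonempty when M is symmetric of positive size,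
   so that this infimum is then the least eigenvalue. *)
Definition min_eigenvalue m (M : 'M[R]_m) : R := inf [set a | eigenvalue M a].

Lemma min_eigenvalueE m (M : 'M[R]_m) a :
  eigenvalue M a -> (forall b, eigenvalue M b -> a <= b) ->
  min_eigenvalue M = a.
Proof.
move=> Ma minM; apply/eqP; rewrite eq_le; apply/andP; split.
  by apply: ge_inf => //; exists a.
by apply: lb_le_inf; [exists a|].
Qed.

Definition energy W c d X : R :=
  let x := colstack X in (x^T *m W *m x) 0 0 + (c^T *m x) 0 0 + d.

Definition shifted_energy W c d (a : R) X : R :=
  energy W c d X - a * frobenius_norm X ^+ 2 + a * n%:R.

(* Optimal values are infima in the extended reals, so that no attainment or
   boundedness is presupposed. *)
Definition val_S W c d : \bar R :=
  ereal_inf [set (energy W c d X)%:E |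
    X in [set X | frobenius_norm X ^+ 2 = n%:R]].

Definition val_DS W c d : \bar R :=
  ereal_inf [set (energy W c d X)%:E | X in [set X | ds_matrix X]].

Definition val_DSp W c d : \bar R :=
  ereal_inf [set (shifted_energy W c d (min_eigenvalue W) X)%:E |
    X in [set X | ds_matrix X]].

Definition val_DSpp m W c d (F : 'M[R]_(n * n, m)) : \bar R :=
  ereal_inf [set (shifted_energy W c d (min_eigenvalue (F^T *m W *m F)) X)%:E |
    X in [set X | ds_matrix X]].

Definition sdp_energy W c d X Y : R :=
  \tr (W *m Y) + (c^T *m colstack X) 0 0 + d.

Record sdp_feasible X Y : Prop := SdpFeasible {
  sdp_sym : Y^T = Y;
  sdp_trace : \tr Y = n%:R;
  sdp_x_ge0 : forall k, 0 <= colstack X k 0;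
  sdp_eqs : ds_eqs_lhs *m colstack X = ds_eqs_rhs;
  sdp_psd : psd (Y - colstack X *m (colstack X)^T);
  sdp_Y_ge0 : forall k l, 0 <= Y k l;
  sdp_sum : \sum_q \sum_r \sum_s \sum_t Y (pos q r) (pos s t) = n%:R ^+ 2;
  sdp_bound : forall q r s t : 'I_n,
    Y (pos q r) (pos s t) <=
      if (q == s) && (r != t) || (r == t) && (q != s) then 0
      else Num.min (X q r) (X s t)
}.

Definition val_SDP W c d : \bar R :=
  ereal_inf [set (sdp_energy W c d XY.1 XY.2)%:E |
    XY in [set XY | sdp_feasible XY.1 XY.2]].

End Relaxations.

Arguments ds_eqs_lhs R n : clear implicits.

(* Main.v *)
(** Let [(X, Y)] be feasible for SDP and [Z = Y - x x^T], which is positive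
    semidefinite.  The sign constraints make [Y] diagonal on each row and each
    column of [X], with diagonal at most [x], and [x] sums to 1 there; so the
    corresponding row [a] of [A] satisfies [a Z a^T <= 1 - 1 = 0], hence
    [Z a^T = 0].  The range of [Z] thus lies in that of [F], whence
    [tr (W Z) >= lambda tr Z = lambda (n - |X|^2)] for the least eigenvalue
    [lambda] of [F^T W F]; this is the SDP bound over DS++.
    The energy shifted by [a] is nondecreasing in [a] on doubly stochastic
    matrices, since [|X|^2 <= n], and compressing [W] by an isometry does not
    decrease its least eigenvalue.  Finally, for [c = 0], the spectral value
    [n lambda_min + d] is attained at an eigenvector and bounds the energy
    shifted by [lambda_min] from below everywhere. *)
Require Import Defs.
From HB Require Import structures.
From mathcomp Require Import all_boot all_order all_algebra.
From mathcomp Require Import all_classical all_reals all_analysis.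
From mathcomp Require Import ring lra.
Set Implicit Arguments.
Unset Strict Implicit.
Unset Printing Implicit Defensive.
Import Order.TTheory GRing.Theory Num.Theory.
Local Open Scope ring_scope.

(** * Quadratic forms and least eigenvalues of symmetric matrices *)

Section QuadraticForms.
Variables (R : realType) (m : nat).
Implicit Types (M Z : 'M[R]_m) (u v w : 'cV[R]_m) (a : R).

Definition bform M u v : R := (u^T *m M *m v) 0 0.

Definition sqnorm v : R := \sum_i v i 0 ^+ 2.

Lemma bformDl M u v w : bform M (u + v) w = bform M u w + bform M v w.
Proof. by rewrite /bform linearD /= !mulmxDl mxE. Qed.

Lemma bformDr M u v w : bform M w (u + v) = bform M w u + bform M w v.
Proof. by rewrite /bform mulmxDr mxE. Qed.

Lemma bformZl M a u v : bform M (a *: u) v = a * bform M u v.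
Proof. by rewrite /bform linearZ /= -!scalemxAl mxE. Qed.

Lemma bformZr M a u v : bform M u (a *: v) = a * bform M u v.
Proof. by rewrite /bform -scalemxAr mxE. Qed.

Lemma bformC M u v : M^T = M -> bform M u v = bform M v u.
Proof.
move=> sM; rewrite /bform; set B := u^T *m M *m v.
have -> : B 0 0 = B^T 0 0 by rewrite [RHS]mxE.
by rewrite !trmx_mul trmxK sM mulmxA.
Qed.

Lemma bform_delta M i j : bform M (delta_mx i 0) (delta_mx j 0) = M i j.
Proof. by rewrite /bform trmx_delta -rowE -colE !mxE. Qed.

Lemma bformB M Z u v : bform (M - Z) u v = bform M u v - bform Z u v.
Proof. by rewrite /bform mulmxBr mulmxBl !mxE. Qed.

Lemma bform_sum M u v : bform M u v = \sum_i \sum_j u i 0 * M i j * v j 0.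
Proof.
rewrite /bform mxE exchange_big; apply: eq_bigr => j _ /=.
by rewrite mxE mulr_suml; apply: eq_bigr => i _; rewrite mxE.
Qed.

Lemma sqnormE v : (v^T *m v) 0 0 = sqnorm v.
Proof. by rewrite mxE; apply: eq_bigr => i _; rewrite mxE -expr2. Qed.

Lemma bform_scalar a v : bform a%:M v v = a * sqnorm v.
Proof.
by rewrite /bform mul_mx_scalar -scalemxAl mxE sqnormE.
Qed.

Lemma sqnormZ a v : sqnorm (a *: v) = a ^+ 2 * sqnorm v.
Proof.
by rewrite /sqnorm mulr_sumr; apply: eq_bigr => i _; rewrite mxE exprMn.
Qed.

Lemma sqnorm_ge0 v : 0 <= sqnorm v.
Proof. by apply: sumr_ge0 => i _; apply: sqr_ge0. Qed.

Lemma sqnorm_gt0 v : v != 0 -> 0 < sqnorm v.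
Proof.
move=> v0; rewrite lt_def sqnorm_ge0 andbT; apply: contra v0.
rewrite psumr_eq0 => [|i _]; last exact: sqr_ge0.
move=> /allP v0; apply/eqP/colP => i; rewrite mxE.
by have := v0 i (mem_index_enum _); rewrite sqrf_eq0 => /eqP.
Qed.

(** The usual discriminant argument. As [M] is only semidefinite, one divides by whichever of
    [bform M u u] and [bform M v v] is nonzero. *)
Lemma psd_CauchySchwarz M u v : psd M ->
  bform M u v ^+ 2 <= bform M u u * bform M v v.
Proof.
move=> [sM pM].
have qE a b : 0 <= a ^+ 2 * bform M u u + a * b * bform M u v *+ 2
                   + b ^+ 2 * bform M v v.
  have := pM (a *: u + b *: v); rewrite -/(bform _ _ _).
  rewrite !bformDl !bformDr !bformZl !bformZr (bformC v u sM) => h.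
  apply: le_trans h _; rewrite le_eqVlt; apply/orP; left; apply/eqP; ring.
have := pM u; have := pM v; rewrite -!/(bform _ _ _).
move: (bform M u u) (bform M u v) (bform M v v) qE => p b q qE q0 p0.
have [/eqP p0'|p_n0] := eqVneq p 0.
  have [/eqP q0'|q_n0] := eqVneq q 0.
    (* When both vanish, the form at [u - b v] is [- 2 b^2], which forces [b = 0]. *)
    have := qE 1 (- b); rewrite (eqP p0') (eqP q0'); nra.
  have q1 : 0 < q by rewrite lt_def q_n0.
  have := qE q (- b).
  have -> : q ^+ 2 * p + q * - b * b *+ 2 + (- b) ^+ 2 * q = q * (p * q - b ^+ 2).
    by ring.
  by rewrite pmulr_rge0 // subr_ge0.
have p1 : 0 < p by rewrite lt_def p_n0.
have := qE (- b) p.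
have -> : (- b) ^+ 2 * p + - b * p * b *+ 2 + p ^+ 2 * q = p * (p * q - b ^+ 2).
  by ring.
by rewrite pmulr_rge0 // subr_ge0.
Qed.

(** Entry [i] of [M *m v] is the form at the [i]-th basis vector and [v], which Cauchy-Schwarz
    forces to vanish. *)
Lemma psd_bform0 M v : psd M -> bform M v v = 0 -> M *m v = 0.
Proof.
move=> pM v0; apply/colP => i; rewrite [RHS]mxE; apply/eqP.
rewrite -sqrf_eq0 eq_le sqr_ge0 andbT.
have := psd_CauchySchwarz (delta_mx i 0) v pM.
by rewrite v0 mulr0 /bform trmx_delta -rowE -row_mul mxE.
Qed.

(* Eliminating a nonzero diagonal entry of [Z] subtracts from [Z] a multiple of
   a rank one matrix [z *m z^T], for which the trace is [bform M z z]. *)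
Lemma psd_mxtrace_mul_ge0 M Z : psd M -> psd Z -> 0 <= \tr (M *m Z).
Proof.
move=> pM; have [k] := ubnP #|[pred i | Z i i != 0]|.
elim: k Z => // k IHk Z leZk pZ.
have entry Z' i j : psd Z' -> Z' i j ^+ 2 <= Z' i i * Z' j j.
  by move=> pZ'; rewrite -!bform_delta; apply: psd_CauchySchwarz.
case: (pickP [pred i | Z i i != 0]) => [i /= Zi|Z0]; last first.
  suff -> : Z = 0 by rewrite mulmx0 mxtrace0.
  apply/matrixP => i j; rewrite [RHS]mxE; apply/eqP.
  rewrite -sqrf_eq0 eq_le sqr_ge0 andbT; apply: le_trans (entry _ i j pZ) _.
  by have /= /negbFE/eqP -> := Z0 i; rewrite mul0r.
have [sZ Zge0] := pZ.
have Zi0 : 0 < Z i i.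
  by rewrite lt_def Zi -bform_delta; apply: Zge0.
pose z := col i Z; pose Z' := Z - (Z i i)^-1 *: (z *m z^T).
have zE v : (z^T *m v) 0 0 = bform Z (delta_mx i 0) v.
  by rewrite /bform trmx_delta -rowE /z tr_col sZ.
have Z'v v : bform Z' v v =
    bform Z v v - (Z i i)^-1 * bform Z (delta_mx i 0) v ^+ 2.
  rewrite bformB; congr (_ - _).
  rewrite {1}/bform -scalemxAr -scalemxAl mxE; congr (_ * _).
  have -> : v^T *m (z *m z^T) *m v = (z^T *m v)^T *m (z^T *m v).
    by rewrite trmx_mul trmxK !mulmxA.
  by rewrite [LHS]mxE big_ord1 [X in X * _]mxE zE.
have pZ' : psd Z'.
  split=> [|v]; first by rewrite linearB linearZ /= trmx_mul trmxK sZ.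
  rewrite -/(bform _ _ _) Z'v subr_ge0 mulrC ler_pdivrMr // mulrC.
  by rewrite -(bform_delta Z i i) psd_CauchySchwarz.
have Z'E j l : Z' j l = Z j l - (Z i i)^-1 * (Z j i * Z l i).
  by rewrite !mxE big_ord1 !mxE.
have -> : Z = Z' + (Z i i)^-1 *: (z *m z^T) by rewrite subrK.
rewrite mulmxDr mxtraceD addr_ge0 //.
  (* The count drops: entry [i] becomes zero, and a zero diagonal entry [j] stays zero because
     [Z j i] vanishes with [Z j j]. *)
  apply: IHk => //; apply: leq_trans _ (leZk : (_ <= k)%N); apply: proper_card.
  apply/fintype.properP; split; last first.
    by exists i; rewrite !inE // Z'E mulKf // subrr eqxx.
  apply/fintype.subsetP => j; rewrite !inE; apply: contra => /eqP Zj.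
  have /eqP : Z j i ^+ 2 = 0.
    apply/eqP; rewrite eq_le sqr_ge0 andbT.
    by apply: le_trans (entry _ j i pZ) _; rewrite Zj mul0r.
  by rewrite sqrf_eq0 Z'E Zj => /eqP ->; rewrite mulr0 mulr0 subrr.
rewrite -scalemxAr mxtraceZ mulr_ge0 ?invr_ge0 ?(ltW Zi0) //.
by rewrite mulmxA mxtrace_mulC trace_mx11 mulmxA; apply: (proj2 pM).
Qed.

Lemma bform_le_sqnorm M :
  exists2 C, 0 < C & forall v, `|bform M v v| <= C * sqnorm v.
Proof.
(* The summand 1 keeps the constant positive even for [M = 0], so that it can be inverted. *)
exists (1 + \sum_i \sum_j `|M i j|) => [|v].
  by rewrite ltr_wpDr // sumr_ge0 // => i _; rewrite sumr_ge0.
rewrite mulrDl mul1r ler_wpDl ?sqnorm_ge0 // bform_sum mulr_suml.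
apply: le_trans (ler_norm_sum _ _ _) _; apply: ler_sum => i _.
rewrite mulr_suml; apply: le_trans (ler_norm_sum _ _ _) _.
apply: ler_sum => j _; rewrite !normrM mulrAC mulrC ler_wpM2l //.
have le_sq k : `|v k 0| ^+ 2 <= sqnorm v.
  rewrite real_normK ?num_real // /sqnorm (bigD1 k) //= ler_wpDr //.
  by apply: sumr_ge0 => l _; apply: sqr_ge0.
have := le_sq i; have := le_sq j; have := sqr_ge0 (`|v i 0| - `|v j 0|).
move: (sqnorm v) `|v i 0| `|v j 0| => s x y; nra.
Qed.

(* If the infimum [a] of the Rayleigh quotient were not an eigenvalue, then
   [N = M - a] would be invertible, and Cauchy-Schwarz for [v] and [N^-1 v]
   would bound the quotient away from [a]. *)
Lemma min_eigenvalueP M : (0 < m)%N -> M^T = M ->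
  eigenvalue M (min_eigenvalue M) /\ psd (M - (min_eigenvalue M)%:M).
Proof.
move=> m0 sM.
pose S :=
  [set bform M v v / sqnorm v | v in [set v : 'cV[R]_m | v != 0]]%classic.
have S0 : (S !=set0)%classic.
  pose i := Ordinal m0; pose e : 'cV[R]_m := delta_mx i 0.
  exists (bform M e e / sqnorm e), e => //=; apply/eqP => /colP/(_ i).
  by rewrite !mxE !eqxx; apply/eqP; rewrite oner_eq0.
have lbS : has_lbound S.
  have [C _ leC] := bform_le_sqnorm M.
  exists (- C) => _ [v v0 <-]; rewrite ler_pdivlMr ?sqnorm_gt0 // mulNr.
  by rewrite lerNl; apply: le_trans (leC v); rewrite -normrN ler_norm.
pose a := inf S.
have le_a v : a * sqnorm v <= bform M v v.
  have [->|v0] := eqVneq v 0.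
    by rewrite -(scale0r 0) sqnormZ bformZl expr0n /= !mul0r mulr0.
  by rewrite -ler_pdivlMr ?sqnorm_gt0 //; apply: ge_inf => //; exists v.
have pN : psd (M - a%:M).
  split=> [|v]; first by rewrite linearB /= tr_scalar_mx sM.
  by rewrite -/(bform _ _ _) bformB bform_scalar subr_ge0.
have Ma : eigenvalue M a.
  rewrite /eigenvalue /eigenspace kermx_eq0 row_free_unit; apply/negP.
  set N := M - _ in pN * => uN.
  have [C C0 leC] := bform_le_sqnorm (invmx N).
  suff : a + C^-1 <= a by rewrite gerDl leNgt invr_gt0 C0.
  apply: lb_le_inf => // _ [v /= v0 <-].
  have s0 := sqnorm_gt0 v0.
  rewrite ler_pdivlMr // mulrDl addrC -lerBrDr -(bform_scalar a) -bformB -/N.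
  rewrite mulrC ler_pdivrMr // -(ler_pM2l s0) -expr2.
  have := psd_CauchySchwarz v (invmx N *m v) pN.
  rewrite {1}/bform -mulmxA mulKVmx // sqnormE => /le_trans; apply.
  rewrite mulrCA ler_wpM2l ?(proj2 pN) // mulrC.
  apply: le_trans (ler_norm _) _; apply: le_trans (leC v); rewrite le_eqVlt.
  by rewrite /bform trmx_mul trmx_inv (proj1 pN) mulmxKV // mulmxA eqxx.
have -> : min_eigenvalue M = a; last by [].
(* Eigenvectors are row vectors here; the Rayleigh quotient at the transpose of one is its
   eigenvalue. *)
apply: min_eigenvalueE => // b /eigenvalueP[v vM v0].
have v0' : v^T != 0 by rewrite -(trmx0 R 1 m) (inj_eq trmx_inj).
have := le_a v^T; rewrite /bform trmxK vM -scalemxAl mxE.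
by rewrite -{2}(trmxK v) sqnormE ler_pM2r ?sqnorm_gt0.
Qed.

End QuadraticForms.

Lemma psd_eigenvalue_ge0 (R : realType) m (M : 'M[R]_m) a :
  psd M -> eigenvalue M a -> 0 <= a.
Proof.
move=> [_ pM] /eigenvalueP[v vM v0].
have v0' : v^T != 0 by rewrite -(trmx0 R 1 m) (inj_eq trmx_inj).
have := pM v^T; rewrite trmxK vM -scalemxAl mxE -{1}(trmxK v) sqnormE.
by rewrite pmulr_lge0 // sqnorm_gt0.
Qed.

(** As [F^T *m F = 1], compressing [W - a] gives [F^T *m W *m F - a]; with [a] the least eigenvalue
    of [W] this is positive semidefinite. *)
Lemma min_eigenvalue_compress (R : realType) m p (W : 'M[R]_m)
    (F : 'M[R]_(m, p)) : (0 < m)%N -> (0 < p)%N -> W^T = W ->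
  F^T *m F = 1%:M -> min_eigenvalue W <= min_eigenvalue (F^T *m W *m F).
Proof.
move=> m0 p0 sW FF; have [_ [_ pW]] := min_eigenvalueP m0 sW.
have sFWF : (F^T *m W *m F)^T = F^T *m W *m F.
  by rewrite !trmx_mul trmxK sW mulmxA.
have [lF _] := min_eigenvalueP p0 sFWF.
rewrite -subr_ge0; apply: (@psd_eigenvalue_ge0 _ _
  (F^T *m (W - (min_eigenvalue W)%:M) *m F)).
  split=> [|v].
    by rewrite !trmx_mul trmxK linearB /= tr_scalar_mx sW mulmxA.
  by have := pW (F *m v); rewrite trmx_mul !mulmxA.
have /eigenvalueP[v vE v0] := lF; apply/eigenvalueP; exists v => //.
rewrite mulmxBr mulmxBl mulmxBr vE scalerBl mul_mx_scalar -scalemxAl FF.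
by rewrite -scalemxAr mulmx1.
Qed.

(** Since [F *m F^T] fixes [Z], compressing both [W] and [Z] by [F] preserves [\tr (W *m Z)] and
    [\tr Z]. The shifted compression of [W] and that of [Z] are semidefinite, so their product has
    nonnegative trace. *)
Lemma min_eigenvalue_mxtrace (R : realType) m p (W Z : 'M[R]_m)
    (F : 'M[R]_(m, p)) : (0 < p)%N -> W^T = W -> F^T *m F = 1%:M ->
  psd Z -> Z *m (F *m F^T) = Z ->
  min_eigenvalue (F^T *m W *m F) * \tr Z <= \tr (W *m Z).
Proof.
move=> p0 sW FF [sZ pZ] ZF; set a := min_eigenvalue _.
have sFWF : (F^T *m W *m F)^T = F^T *m W *m F.
  by rewrite !trmx_mul trmxK sW mulmxA.
have [_ pM] := min_eigenvalueP p0 sFWF.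
have pFZF : psd (F^T *m Z *m F).
  split=> [|v]; first by rewrite !trmx_mul trmxK sZ mulmxA.
  by have := pZ (F *m v); rewrite trmx_mul !mulmxA.
have := psd_mxtrace_mul_ge0 pM pFZF.
have FZ : F *m F^T *m Z = Z 
  by apply: trmx_inj; rewrite !trmx_mul trmxK sZ.
rewrite mulmxBl linearB /= subr_ge0 mul_scalar_mx mxtraceZ.
rewrite mxtrace_mulC mulmxA FZ => /le_trans; apply.
rewrite -!mulmxA mxtrace_mulC -!mulmxA ZF.
by rewrite (mulmxA F) FZ.
Qed.

(** * Column stacks and the shifted energy *)

Section ColumnStack.
Variables (R : realType) (n : nat).
Implicit Types (X : 'M[R]_n) (W Y : 'M[R]_(n * n)) (c : 'cV[R]_(n * n)) (d : R).

Lemma sum_pos (f : 'I_(n * n) -> R) : \sum_k f k = \sum_q \sum_r f (pos q r).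
Proof.
rewrite (reindex _ (curry_mxvec_bij _ _)) /=.
rewrite (eq_bigr (fun p => f (mxvec_index p.1 p.2))); last by case.
by rewrite -(pair_bigA _ (fun i j => f (mxvec_index i j))) exchange_big.
Qed.

Lemma frobenius_normE X : frobenius_norm X ^+ 2 = sqnorm (colstack X).
Proof.
rewrite /frobenius_norm sqr_sqrtr.
  rewrite /sqnorm sum_pos; apply: eq_bigr => i _; apply: eq_bigr => j _.
  by rewrite colstackE.
by apply: sumr_ge0 => i _; apply: sumr_ge0 => j _; apply: sqr_ge0.
Qed.

Lemma colstack_surj (v : 'cV[R]_(n * n)) : exists X, colstack X = v.
Proof. by exists (vec_mx v^T)^T; rewrite /colstack trmxK vec_mxK trmxK. Qed.

Lemma energyE W c d X :
  energy W c d X = bform W (colstack X) (colstack X)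
    + (c^T *m colstack X) 0 0 + d.
Proof. by []. Qed.

(** Entries lie between 0 and 1, so squaring does not increase them, and each row sums to 1. *)
Lemma ds_frobenius_le X : ds_matrix X -> frobenius_norm X ^+ 2 <= n%:R.
Proof.
move=> [rX _ X0]; rewrite frobenius_normE /sqnorm sum_pos.
rewrite -[n in leRHS]card_ord -sumr_const; apply: ler_sum => i _.
have Xi : \sum_j X i j = 1.
  have /colP/(_ i) := rX; rewrite !mxE => <-.
  by apply: eq_bigr => j _; rewrite mxE mulr1.
rewrite -Xi; apply: ler_sum => j _; rewrite colstackE expr2 ler_piMl //.
by rewrite -Xi (bigD1 j) //= lerDl; apply: sumr_ge0.
Qed.

Lemma le_shifted_energy W c d X a b : ds_matrix X -> a <= b ->
  shifted_energy W c d a X <= shifted_energy W c d b X.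
Proof.
move=> /ds_frobenius_le leX ab; rewrite /shifted_energy.
set s := _ ^+ 2 in leX *.
have := mulr_ge0 (_ : 0 <= b - a) (_ : 0 <= n%:R - s); rewrite !subr_ge0.
by move=> /(_ ab leX); lra.
Qed.

Lemma shifted_energy0 W c d X : shifted_energy W c d 0 X = energy W c d X.
Proof. by rewrite /shifted_energy !mul0r subr0 addr0. Qed.

(** * Feasible points of the semidefinite relaxation *)

Section SdpFeasible.
Variables (X : 'M[R]_n) (Y : 'M[R]_(n * n)).
Hypothesis XY : sdp_feasible X Y.
Let x := colstack X.
Let Z := Y - x *m x^T.

Lemma sdp_ds : ds_matrix X.
Proof.
have /ds_eqsP[rX cX] := sdp_eqs XY.
by split=> // q r; rewrite -colstackE; apply: sdp_x_ge0 XY _.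
Qed.

(* A row or a column of [X] is a set of positions on which [Y] is diagonal,
   with diagonal at most that of [x]; as [x] sums to 1 there, the indicator of
   this set is isotropic for [Z]. *)
Lemma sdp_isotropic (P : 'I_n -> 'I_n -> bool)
    (a := colstack (\matrix_(q, r) (P q r)%:R)) :
  (forall q r s t, P q r -> P s t -> (q != s) || (r != t) ->
    (q == s) && (r != t) || (r == t) && (q != s)) ->
  (a^T *m x) 0 0 = 1 -> Z *m a = 0.
Proof.
move=> hP ax; have pZ := sdp_psd XY; apply: psd_bform0 => //.
apply/eqP; rewrite eq_le (proj2 pZ) andbT bformB subr_le0.
have -> : bform (x *m x^T) a a = 1.
  have -> : bform (x *m x^T) a a = ((a^T *m x) *m (a^T *m x)^T) 0 0.
    by rewrite /bform trmx_mul trmxK !mulmxA.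
  by rewrite [LHS]mxE big_ord1 ax mul1r [LHS]mxE ax.
rewrite bform_sum -ax mxE sum_pos sum_pos.
apply: ler_sum => q _; apply: ler_sum => r _.
have aE s t : a (pos s t) 0 = (P s t)%:R by rewrite colstackE mxE.
rewrite [a^T _ _]mxE sum_pos (bigD1 q) //= (bigD1 r) //= -addrA.
rewrite -[leRHS]addr0 lerD //.
  rewrite aE /x colstackE.
  case: (P q r); rewrite ?mul0r ?mul1r ?mulr1 ?mul0r //.
  by have := sdp_bound XY q r q r; rewrite !eqxx minxx.
(* Distinct positions in [P] share a row or a column by [hP], so [sdp_bound] bounds [Y] by 0
   there. *)
have off s t : (q != s) || (r != t) ->
    a (pos q r) 0 * Y (pos q r) (pos s t) * a (pos s t) 0 <= 0.
  move=> qrst; rewrite !aE.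
  case Pqr: (P q r); last by rewrite !mul0r.
  case Pst: (P s t); last by rewrite mulr0.
  rewrite mul1r mulr1; have := sdp_bound XY q r s t.
  by rewrite (hP q r s t).
rewrite -[leRHS]addr0 lerD //; apply: sumr_le0 => s hs.
  by apply: off; rewrite orbC eq_sym hs.
by apply: sumr_le0 => t _; apply: off; rewrite eq_sym hs.
Qed.

(** Each row of [ds_eqs_lhs] is the indicator of a row or a column of [X], to which [sdp_isotropic]
    applies. *)
Lemma sdp_ker : Z *m (ds_eqs_lhs R n)^T = 0.
Proof.
apply: trmx_inj; rewrite trmx_mul trmxK trmx0 /ds_eqs_lhs mul_col_mx.
have := sdp_eqs XY; rewrite /ds_eqs_lhs /ds_eqs_rhs mul_col_mx.
rewrite -col_mx_const -col_mx0 => /eq_col_mx[Er Ec].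
congr col_mx; apply/row_matrixP => i; rewrite row0 row_mul rowK -trmx_mul.
  rewrite (sdp_isotropic (P := fun q r => q == i)) ?trmx0 //.
    by move=> q r s t /eqP -> /eqP ->; rewrite eqxx andbF orbF.
  by have := congr1 (row i) Er; rewrite row_mul rowK row_const => ->;
    rewrite mxE.
rewrite (sdp_isotropic (P := fun q r => r == i)) ?trmx0 //.
  by move=> q r s t /eqP -> /eqP ->; rewrite eqxx andbF /= orbF.
by have := congr1 (row i) Ec; rewrite row_mul rowK row_const => ->;
  rewrite mxE.
Qed.

Lemma sdp_energyE W c d :
  sdp_energy W c d X Y = energy W c d X + \tr (W *m Z).
Proof.
rewrite /sdp_energy energyE -/x /Z mulmxBr linearB /=.
have -> : \tr (W *m (x *m x^T)) = bform W x x.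
  by rewrite mulmxA mxtrace_mulC trace_mx11 mulmxA.
ring.
Qed.

Lemma sdp_trace_slack : \tr Z = n%:R - frobenius_norm X ^+ 2.
Proof.
rewrite frobenius_normE -sqnormE /Z linearB /= (sdp_trace XY).
by rewrite mxtrace_mulC trace_mx11.
Qed.

Lemma shifted_energy_le_sdp m W c d (F : 'M[R]_(n * n, m)) :
  (0 < m)%N -> W^T = W -> F^T *m F = 1%:M ->
  (kermx (ds_eqs_lhs R n)^T <= F^T)%MS ->
  shifted_energy W c d (min_eigenvalue (F^T *m W *m F)) X
    <= sdp_energy W c d X Y.
Proof.
move=> m0 sW FF kF.
(* The row space of [Z] lies in that of [F^T], on which [F *m F^T] acts as the identity. *)
have ZF : Z *m (F *m F^T) = Z.
  have /submxP[D ->] : (Z <= F^T)%MS.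
    by apply: submx_trans kF; apply/sub_kermxP/sdp_ker.
  by rewrite mulmxA -(mulmxA D) FF mulmx1.
have := min_eigenvalue_mxtrace m0 sW FF (sdp_psd XY) ZF.
rewrite -/Z sdp_trace_slack sdp_energyE /shifted_energy => le_tr.
by rewrite -addrA lerD2l addrC -mulrBr.
Qed.

End SdpFeasible.

Lemma exists_energy_min W d : (0 < n)%N -> W^T = W ->
  exists2 X, frobenius_norm X ^+ 2 = n%:R &
    energy W 0 d X = min_eigenvalue W * n%:R + d.
Proof.
move=> n0 sW; have nn0 : (0 < n * n)%N by rewrite muln_gt0 n0.
have [/eigenvalueP[v vW v0] _] := min_eigenvalueP nn0 sW.
have v0' : v^T != 0 by rewrite -(trmx0 R 1 (n * n)) (inj_eq trmx_inj).
have s0 := sqnorm_gt0 v0'; set s := sqnorm _ in s0.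
(* The eigenvector is rescaled to squared norm [n]. *)
have [X XE] := colstack_surj (Num.sqrt (n%:R / s) *: v^T).
have XF : frobenius_norm X ^+ 2 = n%:R.
  rewrite frobenius_normE XE sqnormZ sqr_sqrtr; last first.
    by rewrite divr_ge0 ?ler0n ?ltW.
  by rewrite -/s divfK // gt_eqF.
exists X => //; rewrite energyE -XF frobenius_normE XE trmx0 mul0mx mxE addr0.
rewrite bformZl bformZr sqnormZ /bform trmxK vW -scalemxAl mxE.
rewrite -{1}(trmxK v) sqnormE; ring.
Qed.

(** The shift turns the quadratic part into the semidefinite form of [W - min_eigenvalue W], so no
    norm constraint on [X] is involved. *)
Lemma energy_min_le_shifted W d X : (0 < n)%N -> W^T = W ->
  min_eigenvalue W * n%:R + d <= shifted_energy W 0 d (min_eigenvalue W) X.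
Proof.
move=> n0 sW; have nn0 : (0 < n * n)%N by rewrite muln_gt0 n0.
have [_ [_ pW]] := min_eigenvalueP nn0 sW.
have := pW (colstack X); rewrite -/(bform _ _ _) bformB bform_scalar.
rewrite /shifted_energy energyE frobenius_normE trmx0 mul0mx mxE.
lra.
Qed.

End ColumnStack.

(** * Comparison of the optimal values *)

Lemma le_ereal_inf_image (R : realType) (T U : Type) (A : set T) (B : set U)
    (f : T -> R) (g : U -> R) :
  (forall y, B y -> exists2 x, A x & f x <= g y) ->
  (ereal_inf [set (f x)%:E | x in A]%classic
     <= ereal_inf [set (g y)%:E | y in B]%classic)%E.
Proof.
move=> AB; apply: le_ereal_inf_tmp => _ [y By <-].
have [x Ax fg] := AB y By; apply: le_trans (_ : ((f x)%:E <= _)%E).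
  by apply: ereal_inf_lbound; exists x.
by rewrite lee_fin.
Qed.

Theorem theorem1 (R : realType) (n : nat) (hn : (2 <= n)%N)
    (W : 'M[R]_(n * n)) (hW : W^T = W) (c : 'cV[R]_(n * n)) (d : R)
    (F : 'M[R]_(n * n, n.-1 * n.-1))
    (hF_orth : F^T *m F = 1%:M)
    (hF_span : (F^T == kermx (ds_eqs_lhs R n)^T)%MS) :
  [/\ (* (i) *)
      (val_DSp W c d <= val_DSpp W c d F)%E,
      (* (ii) *)
      (c = 0 -> (val_S W c d <= val_DSp W c d)%E) /\
      (psd W -> (val_DS W c d <= val_DSp W c d)%E)
    & (* (iii) *)
      [/\ (val_DSpp W c d F <= val_SDP W c d)%E,
          (val_DSp W c d <= val_SDP W c d)%E,
          c = 0 -> (val_S W c d <= val_SDP W c d)%E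
        & psd W -> (val_DS W c d <= val_SDP W c d)%E]].
Proof.
have n0 : (0 < n)%N by apply: leq_trans hn.
have nn0 : (0 < n * n)%N by rewrite muln_gt0 n0.
(* Here [2 <= n] matters: [F^T *m W *m F] has positive size, so its [min_eigenvalue] is not the
   infimum of an empty set. *)
have m0 : (0 < n.-1 * n.-1)%N by rewrite muln_gt0 -subn1 subn_gt0 hn.
have i : (val_DSp W c d <= val_DSpp W c d F)%E.
  apply: le_ereal_inf_image => X dsX; exists X => //.
  by apply: le_shifted_energy dsX _; apply: min_eigenvalue_compress.
have iiS : c = 0 -> (val_S W c d <= val_DSp W c d)%E.
  move=> ->; apply: le_ereal_inf_image => X _.
  have [X' nX' EX'] := exists_energy_min d n0 hW.
  by exists X'; rewrite // EX' energy_min_le_shifted.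
have iiDS : psd W -> (val_DS W c d <= val_DSp W c d)%E.
  move=> pW; apply: le_ereal_inf_image => X dsX; exists X => //.
  (* (DS) is the relaxation with shift 0, and the least eigenvalue of a semidefinite [W] is
     nonnegative. *)
  rewrite -shifted_energy0; apply: le_shifted_energy dsX _.
  by have [lW _] := min_eigenvalueP nn0 hW; apply: psd_eigenvalue_ge0 lW.
have iii : (val_DSpp W c d F <= val_SDP W c d)%E.
  apply: le_ereal_inf_image => -[X Y] /= XY; exists X; first exact: sdp_ds XY.
  by apply: shifted_energy_le_sdp => //; case/andP: hF_span.
have iii' := le_trans i iii; split=> //; split=> // [c0|pW].
  exact: le_trans (iiS c0) iii'.
exact: le_trans (iiDS pW) iii'.
Qed.
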